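(* Let $N\ge 1$, let $\xi_0<\dots<\xi_N$ be the Gauss-Lobatto nodes on $[-1,1]$, and let $\mathbf{D}=(D_{im})_{i,m=0}^N$ be the associated polynomial derivative matrix. Let $\underline{a}=(a_0,\dots,a_N)^T$, $\underline{b}=(b_0,\dots,b_N)^T$, $\underline{c}=(c_0,\dots,c_N)^T$ be arbitrary real nodal vectors. Write $\{\{a\}\}_{im}:=\frac12(a_i+a_m)$ (similarly for $b,c$), and let $\underline{\underline{a}}=\mathrm{diag}(\underline{a})$, $\underline{\underline{b}}=\mathrm{diag}(\underline{b})$, $\underline{\underline{c}}=\mathrm{diag}(\underline{c})$. Then for every $i=0,\dots,N$: $$2\sum_{m=0}^N D_{im}\{\{a\}\}_{im}=(\mathbf{D}\,\underline{a})_i,$$ $$2\sum_{m=0}^N D_{im}\{\{a\}\}_{im}\{\{b\}\}_{im}=\frac12\left(\mathbf{D}\,\underline{\underline{a}}\,\underline{b}+\underline{\underline{a}}\,\mathbf{D}\,\underline{b}+\underline{\underline{b}}\,\mathbf{D}\,\underline{a}\right)_i,$$ $$2\sum_{m=0}^N D_{im}\{\{a\}\}_{im}\{\{b\}\}_{im}\{\{c\}\}_{im}=\frac14\left(\mathbf{D}\,\underline{\underline{a}}\,\underline{\underline{b}}\,\underline{c}+\underline{\underline{a}}\,\mathbf{D}\,\underline{\underline{b}}\,\underline{c}+\underline{\underline{b}}\,\mathbf{D}\,\underline{\underline{a}}\,\underline{c}+\underline{\underline{c}}\,\mathbf{D}\,\underline{\underline{a}}\,\underline{b}+\underline{\underl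ine{b}}\,\underline{\underline{c}}\,\mathbf{D}\,\underline{a}+\underline{\underline{a}}\,\underline{\underline{c}}\,\mathbf{D}\,\underline{b}+\underline{\underline{a}}\,\underline{\underline{b}}\,\mathbf{D}\,\underline{c}\right)_i.$$
   Context: The polynomial derivative matrix is $D_{im}=\ell_m'(\xi_i)$, where $\ell_m(\xi)=\prod_{r\ne m}\frac{\xi-\xi_r}{\xi_m-\xi_r}$ are the Lagrange basis polynomials of the Gauss-Lobatto nodes. With the diagonal mass matrix $\mathbf{M}=\mathrm{diag}(\omega_0,\dots,\omega_N)$ of Gauss-Lobatto quadrature weights and $\mathbf{Q}=\mathbf{M}\mathbf{D}$, the summation-by-parts property $\mathbf{Q}+\mathbf{Q}^T=\mathrm{diag}(-1,0,\dots,0,1)$ holds. *)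

(* Defs.v *)
From mathcomp Require Import all_boot all_order all_algebra.
From mathcomp Require Import reals.

Set Implicit Arguments.
Unset Strict Implicit.
Unset Printing Implicit Defensive.

Import Order.TTheory GRing.Theory Num.Theory.
Local Open Scope ring_scope.

(* Legendre polynomial P_n, by Rodrigues' formula. *)
Definition legendre (R : realType) (n : nat) : {poly R} :=
  (2 ^+ n * n`!%:R)^-1 *: (('X^2 - 1) ^+ n)^`(n).

(* The Gauss-Lobatto nodes on [-1, 1] are the zeros of (1 - x^2) P_N'(x),
   listed in increasing order. *)
Definition gauss_lobatto_nodes (R : realType) (N : nat)
    (xi : 'I_N.+1 -> R) : Prop :=
  (forall i j : 'I_N.+1, (i < j)%N -> xi i < xi j) /\
  (forall x : R,
     root ((1 - 'X^2) * (legendre R N)^`()) x <-> exists i, x = xi i).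

(* [qpoly.lagrange] samples at a sequence indexed by all of [nat] and required
   to be injective there, hence this version for finitely many nodes. *)
Definition lagrange_poly (R : realType) (N : nat) (xi : 'I_N.+1 -> R)
    (m : 'I_N.+1) : {poly R} :=
  \prod_(r < N.+1 | r != m) ((xi m - xi r)^-1 *: ('X - (xi r)%:P)).

Definition deriv_mx (R : realType) (N : nat) (xi : 'I_N.+1 -> R) :
    'M[R]_N.+1 :=
  \matrix_(i, m) (lagrange_poly xi m)^`().[xi i].

Definition avg (R : realType) (N : nat) (a : 'cV[R]_N.+1) (i m : 'I_N.+1) : R :=
  2^-1 * (a i 0 + a m 0).

Definition diag_cV (R : realType) (N : nat) (a : 'cV[R]_N.+1) : 'M[R]_N.+1 :=
  diag_mx a^T.

(* Main.v *)
Require Import Defs.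
From mathcomp Require Import all_boot all_order all_algebra.
From mathcomp Require Import reals.
From mathcomp Require Import ring.

(** Expanding a product of averages over [m] produces one term for each way of
    choosing, in every factor, the value at [i] or the value at [m].  A factor
    taken at [i] leaves the sum, which on the matrix side is a diagonal matrix
    to the left of [D]; a factor taken at [m] stays under the sum, that is, to
    the right of [D].  The right-hand sides list all these terms but one: the
    term in which every factor is taken at [i] is a multiple of the [i]-th row
    sum of [D].  The identities therefore amount to the vanishing of the row
    sums of [D] (lemma [deriv_mx_row_sum]): the Lagrange basis polynomials add
    up to the constant 1 (lemma [sum_lagrange_poly]), whose derivative is 0.
    That sum is 1 because it interpolates the constant 1 at nodes that are
    pairwise distinct, the Gauss-Lobatto nodes being strictly increasing. *)

Set Implicit Arguments.
Unset Strict Implicit.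
Unset Printing Implicit Defensive.

Import Order.TTheory GRing.Theory Num.Theory.
Local Open Scope ring_scope.

Lemma size_lagrange_poly (R : realType) (N : nat) (xi : 'I_N.+1 -> R) m :
  (size (lagrange_poly xi m) <= N.+1)%N.
Proof.
apply: leq_trans (size_poly_prod_leq _ _) _.
have card_factors : #|[pred r : 'I_N.+1 | r != m]| = N.
  by have := cardC1 m; rewrite card_ord.
rewrite leq_subLR addnS ltnS card_factors addnn -muln2.
rewrite -[X in (_ <= X * _)%N]card_factors -sum_nat_const.
by apply: leq_sum => r _; rewrite (leq_trans (size_scale_leq _ _)) ?size_XsubC.
Qed.

Lemma lagrange_poly_node (R : realType) (N : nat) (xi : 'I_N.+1 -> R) m j :
  injective xi -> (lagrange_poly xi m).[xi j] = (j == m)%:R.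
Proof.
move=> xi_inj; rewrite horner_prod; have [-> | jm] := eqVneq j m.
  rewrite big1 // => r rm; rewrite hornerZ hornerXsubC mulVf //.
  by rewrite subr_eq0 (inj_eq xi_inj) eq_sym.
by rewrite (bigD1 j) //= hornerZ hornerXsubC subrr mulr0 mul0r.
Qed.

(** The difference of the two sides has degree at most [N] and vanishes at the
    [N + 1] distinct nodes. *)
Lemma sum_lagrange_poly (R : realType) (N : nat) (xi : 'I_N.+1 -> R) :
  injective xi -> \sum_(m < N.+1) lagrange_poly xi m = 1.
Proof.
move=> xi_inj; apply/eqP; rewrite -subr_eq0; apply/eqP.
apply: (@roots_geq_poly_eq0 _ _ [seq xi j | j <- enum 'I_N.+1]).
- apply/allP => _ /mapP[j _ ->]; rewrite /root hornerD hornerN hornerC horner_sum.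
  rewrite (bigD1 j) //= lagrange_poly_node // eqxx big1 ?addr0 ?subrr // => m mj.
  by rewrite lagrange_poly_node // eq_sym (negbTE mj).
- by rewrite map_inj_uniq ?enum_uniq.
- rewrite size_map size_enum_ord (leq_trans (size_polyD _ _)) // geq_max.
  rewrite size_polyN size_poly1 andbT (leq_trans (size_sum _ _ _)) //.
  by apply/bigmax_leqP => m _; exact: size_lagrange_poly.
Qed.

Lemma deriv_mx_row_sum (R : realType) (N : nat) (xi : 'I_N.+1 -> R) i :
  injective xi -> \sum_(m < N.+1) deriv_mx xi i m = 0.
Proof.
move=> xi_inj; under eq_bigr do rewrite mxE.
by rewrite -horner_sum -raddf_sum /= sum_lagrange_poly // derivC horner0.
Qed.

Lemma gauss_lobatto_nodes_inj (R : realType) (N : nat) (xi : 'I_N.+1 -> R) :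
  gauss_lobatto_nodes xi -> injective xi.
Proof.
case=> xi_lt _ i j eq_xi; apply: val_inj; apply/eqP.
by case: ltngtP => // /xi_lt; rewrite eq_xi ltxx.
Qed.

Lemma mul_diag_cVE (R : realType) (N : nat) (a v : 'cV[R]_N.+1) i :
  (diag_cV a *m v) i 0 = a i 0 * v i 0.
Proof. by rewrite mul_diag_mx !mxE. Qed.

Theorem lemma1 (R : realType) (N : nat) (hN : (1 <= N)%N)
    (xi : 'I_N.+1 -> R) (hxi : gauss_lobatto_nodes xi)
    (a b c : 'cV[R]_N.+1) (i : 'I_N.+1) :
  let D := deriv_mx xi in
  let A := diag_cV a in
  let B := diag_cV b in
  let C := diag_cV c in
  [/\ 2 * (\sum_(m < N.+1) D i m * avg a i m) = (D *m a) i 0,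
      2 * (\sum_(m < N.+1) D i m * avg a i m * avg b i m) =
        2^-1 * (D *m A *m b + A *m D *m b + B *m D *m a) i 0
    & 2 * (\sum_(m < N.+1) D i m * avg a i m * avg b i m * avg c i m) =
        4^-1 * (D *m A *m B *m c + A *m D *m B *m c + B *m D *m A *m c
                + C *m D *m A *m b + B *m C *m D *m a + A *m C *m D *m b
                + A *m B *m D *m c) i 0].
Proof.
move=> D A B C.
have addD0 (y x : R) : x = x + y * \sum_(m < N.+1) D i m.
  rewrite deriv_mx_row_sum ?mulr0 ?addr0 //; exact: gauss_lobatto_nodes_inj.
have DE (v : 'cV[R]_N.+1) : (D *m v) i 0 = \sum_(m < N.+1) D i m * v m 0.
  by rewrite mxE.
have addE (u v : 'cV[R]_N.+1) : (u + v) i 0 = u i 0 + v i 0 by rewrite mxE.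
(* Each right-hand side is completed by its missing term, a vanishing multiple
   of the row sum of [D]; the two sides then agree term by term under the sum over [m]. *)
split.
- rewrite DE [RHS](addD0 (a i 0)) !mulr_sumr -!big_split /=.
  by apply: eq_bigr => m _; rewrite /avg; field.
- rewrite -!mulmxA !addE !mul_diag_cVE !DE.
  rewrite [X in _ = _ * X](addD0 (a i 0 * b i 0)).
  rewrite !mulr_sumr -!big_split /= mulr_sumr.
  by apply: eq_bigr => m _; rewrite !mul_diag_cVE /avg; field.
- rewrite -!mulmxA !addE !mul_diag_cVE !DE.
  rewrite [X in _ = _ * X](addD0 (a i 0 * b i 0 * c i 0)).
  rewrite !mulr_sumr -!big_split /= mulr_sumr.
  by apply: eq_bigr => m _; rewrite !mul_diag_cVE /avg; field.
Qed.
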